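(* With $c_n(k)$ and $\tilde c_n(k)$ ($n,k\ge0$) as defined in the context, the following identities of formal power series in $t$ and $q$ hold: $$\sum_{k,n\ge 0}c_n(k)\,t^kq^n=\frac{1}{(q,tq^2;tq^2)_\infty},\qquad \sum_{k,n\ge0}\tilde c_n(k)\,t^kq^n=\frac{1}{(tq^2,tq^3;tq^2)_\infty}.$$
   Context: A partition of $n$ is a weakly decreasing finite sequence of positive integers with sum $n$; the empty sequence is the only partition of $0$. Meander: given two compositions (or partitions) $\lambda=(\lambda_1,\dots,\lambda_r)$ and $\mu=(\mu_1,\dots,\mu_s)$ of $n$, the meander of type $\frac{\lambda}{\mu}$ is the graph on $n$ vertices placed in a row, with the following edges. Split the row into consecutive blocks of sizes $\lambda_1,\dots,\lambda_r$, and name the vertices of the $i$-th block, in order, $v_{i,1},\dots,v_{i,\lambda_i}$; for each $i$ and each $1\le j\le\lfloor\lambda_i/2\rfloor$ add a ''top'' edge joining $v_{i,j}$ and $v_{i,\lambda_i+1-j}$. Do the same with $\mu$ in place of $\lambda$ to get ''bottom'' edges. If a top edge and a bottom edge join the same two vertices, both are kept and they form a cycle (of length 2). Every connected component is a cycle or a path, an isolated vertex being counted as a path. Define $\mathrm{ind}_\mu(\lambda)=2C+P-1$, where $C$ and $P$ are the numbers of cycles and paths of the meander. $\mathrm{ind}_{1^n}(\lambda)$ denotes $\mathrm{ind}_\mu(\lambda)$ with $\mu=1^n=(1,1,\dots,1)$ ($n$ ones); for $n=0$ and $\lambda$ empty it is defined to be $-1$. For $n,k\ge 0$: $c_n(k):=\#\{\lambda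 \text{ partition of } n:\ \mathrm{ind}_{1^n}(\lambda)=n-k-1\}$. Writing $f_i$ for the number of parts of $\lambda$ equal to $i$, $\tilde c_n(k):=\#\{\lambda\text{ partition of }n:\ f_1=0,\ \sum_{i\ge1}i(f_{2i}+f_{2i+1})=k\}$. $q$-series notation: $(a;q)_\infty=\prod_{j\ge0}(1-aq^j)$ and $(a_1,\dots,a_m;q)_\infty=(a_1;q)_\infty\cdots(a_m;q)_\infty$; the entry after the semicolon (here $tq^2$) is the base. *)

(* Defs.v *)
From HB Require Import structures.
From mathcomp Require Import all_boot all_order all_algebra.
From mathcomp Require Import boolp classical_sets.

Set Implicit Arguments.
Unset Strict Implicit.
Unset Printing Implicit Defensive.

Import Order.TTheory GRing.Theory Num.Theory.

Local Open Scope nat_scope.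

(** * Partitions *)

Definition is_partition (n : nat) (s : seq nat) : bool :=
  [&& sorted geq s, all (leq 1) s & sumn s == n].

(* A partition of n has at most n parts, each at most n, so the partitions of n
   are counted inside the finite type n.-bseq 'I_n.+1; see [is_partition_bseq]. *)
Definition count_partitions (n : nat) (P : pred (seq nat)) : nat :=
  #|[set s : n.-bseq 'I_n.+1 | is_partition n (map val s) && P (map val s)]|.

Lemma is_partition_bseq (n : nat) (s : seq nat) :
  is_partition n s -> exists b : n.-bseq 'I_n.+1, map val b = s.
Proof.
case/and3P=> _ pos /eqP sum.
have szs : size s <= n.
  rewrite -sum; elim: s pos {sum} => //= x s IH /andP[x0 /IH les].
  by rewrite -add1n leq_add.
have les : all (fun x => x < n.+1) s.
  rewrite -sum; elim: s {pos sum szs} => //= x s IH; rewrite ltnS leq_addr /=.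
  apply: sub_all IH => y; rewrite !ltnS => /leq_trans; apply; exact: leq_addl.
have szb : size [seq inord x : 'I_n.+1 | x <- s] <= n by rewrite size_map.
exists (Bseq szb) => /=; rewrite -map_comp; apply: map_id_in => x xs /=.
by rewrite inordK //; exact: (allP les).
Qed.

(** * Multigraphs and meanders *)

(* An edge is a label together with its set of endpoints; labels allow parallel
   edges. *)
Definition multigraph (L V : finType) := {set L * {set V}}.

Definition adjacent (L V : finType) (E : multigraph L V) : rel V :=
  [rel u v | [exists e in E, e.2 == [set u; v]]].

Definition degree (L V : finType) (E : multigraph L V) (v : V) : nat :=
  #|[set e in E | v \in e.2]|.

Definition components (L V : finType) (E : multigraph L V) : {set {set V}} :=
  equivalence_partition (connect (adjacent E)) [set: V].

Definition edges_in (L V : finType) (E : multigraph L V) (D : {set V}) :=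
  [set e in E | e.2 \subset D].

(* Cycles are the connected 2-regular multigraphs; paths are the trees of
   maximum degree at most 2. Both predicates are applied only to connected
   components D. *)
Definition is_cycle (L V : finType) (E : multigraph L V) (D : {set V}) : bool :=
  [forall v in D, degree E v == 2].

Definition is_path (L V : finType) (E : multigraph L V) (D : {set V}) : bool :=
  [forall v in D, degree E v <= 2] && (#|edges_in E D|.+1 == #|D|).

Definition num_cycles (L V : finType) (E : multigraph L V) : nat :=
  #|[set D in components E | is_cycle E D]|.

Definition num_paths (L V : finType) (E : multigraph L V) : nat :=
  #|[set D in components E | is_path E D]|.

(* Vertices, blocks and positions inside blocks are numbered from 0, so that
   v_{i+1,j+1} is vertex (sumn (take i s) + j). *)
Definition arcs (n : nat) (s : seq nat) : {set {set 'I_n}} :=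
  [set e | [exists i : 'I_(size s), exists j : 'I_((nth 0 s i)./2),
            exists u : 'I_n, exists v : 'I_n,
    [&& u == sumn (take i s) + j :> nat,
        v == sumn (take i s) + ((nth 0 s i).-1 - j) :> nat &
        e == [set u; v]]]].

(* Label true: top edges; label false: bottom edges. *)
Definition meander (n : nat) (lambda mu : seq nat) : multigraph bool 'I_n :=
  [set e | e.2 \in arcs n (if e.1 then lambda else mu)].

Definition meander_index (n : nat) (mu lambda : seq nat) : int :=
  let G := meander n lambda mu in
  ((2 * num_cycles G + num_paths G)%N%:Z - 1)%R.

Definition c (n k : nat) : nat :=
  count_partitions n (fun lambda =>
    meander_index n (nseq n 1) lambda == (n%:Z - k%:Z - 1)%R).

Definition freq (lambda : seq nat) (i : nat) : nat := count_mem i lambda.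

(* The terms with i > sumn lambda of the sum over all i >= 1 vanish. *)
Definition ctilde (n k : nat) : nat :=
  count_partitions n (fun lambda =>
    (freq lambda 1 == 0) &&
    (\sum_(1 <= i < (sumn lambda).+1)
        i * (freq lambda i.*2 + freq lambda i.*2.+1) == k)).

(** * Formal power series *)

Local Open Scope ring_scope.

Record fps (R : Type) : Type := Fps { fcoef : nat -> R }.

Lemma fpsP (R : Type) (f g : fps R) : fcoef f =1 fcoef g -> f = g.
Proof. by case: f g => [f] [g] /= /funext ->. Qed.

HB.instance Definition _ (R : Type) := gen_eqMixin (fps R).
HB.instance Definition _ (R : Type) := gen_choiceMixin (fps R).

Definition fps_zero (R : zmodType) : fps R := Fps (fun=> 0).
Definition fps_opp (R : zmodType) (f : fps R) : fps R :=
  Fps (fun n => - fcoef f n).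
Definition fps_add (R : zmodType) (f g : fps R) : fps R :=
  Fps (fun n => fcoef f n + fcoef g n).

Fact fps_addA (R : zmodType) : associative (@fps_add R).
Proof. by move=> f g h; apply: fpsP => n /=; rewrite addrA. Qed.
Fact fps_addC (R : zmodType) : commutative (@fps_add R).
Proof. by move=> f g; apply: fpsP => n /=; rewrite addrC. Qed.
Fact fps_add0 (R : zmodType) : left_id (fps_zero R) (@fps_add R).
Proof. by move=> f; apply: fpsP => n /=; rewrite add0r. Qed.
Fact fps_addN (R : zmodType) :
  left_inverse (fps_zero R) (@fps_opp R) (@fps_add R).
Proof. by move=> f; apply: fpsP => n /=; rewrite addNr. Qed.

HB.instance Definition _ (R : zmodType) :=
  GRing.isZmodule.Build (fps R)
    (@fps_addA R) (@fps_addC R) (@fps_add0 R) (@fps_addN R).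

Definition fpsC (R : zmodType) (a : R) : fps R :=
  Fps (fun n => if n == 0%N then a else 0).
Definition fpsX (R : nzRingType) : fps R := Fps (fun n => (n == 1%N)%:R).
Definition fps_mul (R : nzRingType) (f g : fps R) : fps R :=
  Fps (fun n => \sum_(i < n.+1) fcoef f i * fcoef g (n - i)%N).

Definition fps_trunc (R : nzRingType) (n : nat) (f : fps R) : {poly R} :=
  \poly_(i < n.+1) fcoef f i.

Lemma coef_fps_trunc (R : nzRingType) (n i : nat) (f : fps R) :
  (i <= n)%N -> (fps_trunc n f)`_i = fcoef f i.
Proof. by move=> lein; rewrite coef_poly ltnS lein. Qed.

Lemma fcoef_mul_trunc (R : nzRingType) (n i : nat) (f g : fps R) :
  (i <= n)%N -> fcoef (fps_mul f g) i = (fps_trunc n f * fps_trunc n g)`_i.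
Proof.
move=> lein; rewrite coefM /=; apply: eq_bigr => j _.
rewrite !coef_fps_trunc ?(leq_trans (leq_subr _ _)) //.
by rewrite (leq_trans _ lein) // -ltnS.
Qed.

Fact fps_mulA (R : comNzRingType) : associative (@fps_mul R).
Proof.
move=> f g h; apply: fpsP => n.
have trunc (u v : fps R) i : (i <= n)%N ->
    (fps_trunc n (fps_mul u v))`_i = (fps_trunc n u * fps_trunc n v)`_i.
  by move=> lein; rewrite coef_fps_trunc // (fcoef_mul_trunc _ _ lein).
rewrite !(fcoef_mul_trunc _ _ (leqnn n)).
transitivity (fps_trunc n f * (fps_trunc n g * fps_trunc n h))`_n.
  by rewrite !coefM; apply: eq_bigr => i _; rewrite trunc // leq_subr.
rewrite mulrA coefM [RHS]coefM; apply: eq_bigr => i _.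
by rewrite trunc // -ltnS.
Qed.

Fact fps_mulC (R : comNzRingType) : commutative (@fps_mul R).
Proof.
move=> f g; apply: fpsP => n.
by rewrite !(fcoef_mul_trunc _ _ (leqnn n)) mulrC.
Qed.

Fact fps_mul1 (R : comNzRingType) : left_id (fpsC (1 : R)) (@fps_mul R).
Proof.
move=> f; apply: fpsP => n /=; rewrite big_ord_recl /= subn0 mul1r.
by rewrite big1 ?addr0 // => i _; rewrite mul0r.
Qed.

Fact fps_mulDl (R : comNzRingType) : left_distributive (@fps_mul R) +%R.
Proof.
move=> f g h; apply: fpsP => n /=; rewrite -big_split.
by apply: eq_bigr => i _; rewrite mulrDl.
Qed.

Fact fps_1neq0 (R : comNzRingType) : fpsC (1 : R) != 0.
Proof.
by apply/eqP => /(congr1 (fun f => fcoef f 0)) /= /eqP; rewrite oner_eq0.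
Qed.

HB.instance Definition _ (R : comNzRingType) :=
  GRing.Zmodule_isComNzRing.Build (fps R)
    (@fps_mulA R) (@fps_mulC R) (@fps_mul1 R) (@fps_mulDl R) (@fps_1neq0 R).

Definition fps_unit (R : comNzRingType) : pred (fps R) :=
  fun f => `[< exists g, g * f = 1 >].
Definition fps_inv (R : comNzRingType) (f : fps R) : fps R :=
  xget f [set g | g * f = 1]%classic.

Fact fps_mulV (R : comNzRingType) :
  {in @fps_unit R, left_inverse 1 (@fps_inv R) *%R}.
Proof. by move=> f /asboolP[g gf]; apply: (@xgetPex _ f [set g | g * f = 1]%classic); exists g. Qed.

Fact fps_unitP (R : comNzRingType) (f g : fps R) : g * f = 1 -> fps_unit f.
Proof. by move=> gf; apply/asboolP; exists g. Qed.

Fact fps_inv_out (R : comNzRingType) :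
  {in [predC @fps_unit R], @fps_inv R =1 id}.
Proof.
move=> f /= /asboolPn nf; rewrite /fps_inv; case: xgetP => // g _ gf.
by case: nf; exists g.
Qed.

HB.instance Definition _ (R : comNzRingType) :=
  GRing.ComNzRing_hasMulInverse.Build (fps R)
    (@fps_mulV R) (@fps_unitP R) (@fps_inv_out R).

(** * Formal power series in t and q, with integer coefficients *)

(* The outer variable is q, the inner one t. *)
Notation fps_tq := (fps (fps int)).

Definition t : fps_tq := fpsC (fpsX int).
Definition q : fps_tq := fpsX (fps int).

(* The coefficient of t^k q^n. *)
Definition coef_tq (f : fps_tq) (k n : nat) : int := fcoef (fcoef f n) k.

(* The series \sum_(k, n) a k n * t^k * q^n. *)
Definition series_tq (a : nat -> nat -> int) : fps_tq :=
  Fps (fun n => Fps (fun k => a k n)).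

(* Convergence in the usual topology: every coefficient is eventually constant. *)
Definition converges_tq (F : nat -> fps_tq) (f : fps_tq) : Prop :=
  forall k n, exists N, forall m, (N <= m)%N ->
    coef_tq (F m) k n = coef_tq f k n.

Definition lim_tq (F : nat -> fps_tq) : fps_tq :=
  xget 0 [set f | converges_tq F f]%classic.

Lemma converges_tq_lim (F : nat -> fps_tq) (f : fps_tq) :
  converges_tq F f -> lim_tq F = f.
Proof.
move=> Ff; apply: xget_unique => // g Fg.
apply: fpsP => n; apply: fpsP => k.
have [N1 FN1] := Ff k n; have [N2 FN2] := Fg k n.
have := FN1 _ (leq_maxl N1 N2); have := FN2 _ (leq_maxr N1 N2).
by move=> eg ef; exact: etrans (esym eg) ef.
Qed.

(* (a; b)_oo and (a_1, ..., a_m; b)_oo. *)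
Definition qpoch (a b : fps_tq) : fps_tq :=
  lim_tq (fun m => \prod_(j < m) (1 - a * b ^+ j)).

Definition qpochs (s : seq fps_tq) (b : fps_tq) : fps_tq :=
  \prod_(a <- s) qpoch a b.

(* Main.v *)
Require Import Defs.
From mathcomp Require Import all_boot all_order all_algebra.
From mathcomp Require Import zify.

(** Against [1^n] the meander has no bottom arcs, so it is a matching with
    [\sum_i floor(lambda_i / 2)] edges; it has no cycle, and
    [n - \sum_i floor(lambda_i / 2)] paths. Hence [c n k] counts the partitions
    of [n] with [\sum_i floor(lambda_i / 2) = k], and [ctilde n k] counts those
    among them without part [1]. Both series are therefore products of
    [1 / (1 - t^(floor(i/2)) q^i)] over the allowed parts [i]: removing one part
    [m+1] gives [G_(m+1) (1 - t^(floor((m+1)/2)) q^(m+1)) = G_m] for the series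
    [G_m] of the partitions with parts at most [m]. Sorting the parts by parity
    gives the two q-Pochhammer symbols. *)

Set Implicit Arguments.
Unset Strict Implicit.
Unset Printing Implicit Defensive.

Import Order.TTheory GRing.Theory Num.Theory.

Local Open Scope nat_scope.

(** * Counting partitions *)

Definition partition_list (n : nat) (P : pred (seq nat)) : seq (seq nat) :=
  [seq map val b | b : n.-bseq 'I_n.+1 in
     [set b : n.-bseq 'I_n.+1 | is_partition n (map val b) && P (map val b)]].

Lemma size_partition_list n P : size (partition_list n P) = count_partitions n P.
Proof. by rewrite size_image. Qed.

Lemma partition_list_uniq n P : uniq (partition_list n P).
Proof.
rewrite map_inj_uniq ?enum_uniq // => b1 b2 /(inj_map val_inj) eqb.
exact: val_inj.
Qed.

Lemma mem_partition_list n P s :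
  (s \in partition_list n P) = is_partition n s && P s.
Proof.
apply/mapP/idP => [[b]|/andP[ps Ps]]; first by rewrite mem_enum inE => ? ->.
have [b eqb] := is_partition_bseq ps.
by exists b; rewrite // mem_enum inE eqb ps.
Qed.

(** Reduces every later count to exhibiting a duplicate-free list with the right members, so that
    bounded sequences can be forgotten. *)
Lemma count_partitions_size n P (L : seq (seq nat)) :
  uniq L -> (forall s, (s \in L) = is_partition n s && P s) ->
  count_partitions n P = size L.
Proof.
move=> uL memL; rewrite -size_partition_list.
apply/perm_size/uniq_perm => //; first exact: partition_list_uniq.
by move=> s; rewrite mem_partition_list memL.
Qed.

Lemma eq_count_partitions n (P Q : pred (seq nat)) :
  (forall s, is_partition n s -> P s = Q s) ->
  count_partitions n P = count_partitions n Q.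
Proof.
move=> PQ; rewrite -[RHS]size_partition_list; apply: count_partitions_size.
  exact: partition_list_uniq.
by move=> s; rewrite mem_partition_list; case: (boolP (is_partition n s)) => // /PQ ->.
Qed.

Definition half_sum (s : seq nat) : nat := sumn [seq x./2 | x <- s].

(** The lower bound [a] treats both identities at once: [a = 0] admits all parts, [a = 1] excludes
    the part 1. *)
Definition bounded_with_half_sum (a m k : nat) : pred (seq nat) :=
  fun s => all (fun x => a < x <= m) s && (half_sum s == k).

Lemma count_partitions_bounded0 a n k :
  count_partitions n (bounded_with_half_sum a a k) = (n == 0) && (k == 0).
Proof.
rewrite (@count_partitions_size _ _
  (if (n == 0) && (k == 0) then [:: [::]] else [::])); first by case: ifP.
  by case: ifP.
case=> [|x s]; rewrite /bounded_with_half_sum /is_partition /=.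
  by rewrite /half_sum /= eq_sym [0 == k]eq_sym; case: ifP.
have -> : (a < x <= a) = false by lia.
by rewrite andbF; case: ifP; rewrite // inE.
Qed.

(** A partition with parts at most [m+1] either has no part [m+1] or starts with one, by sortedness.
    Deleting that one copy is a bijection onto partitions of [n-(m+1)] that may still contain
    [m+1]. *)
Lemma count_partitions_boundedS a m n k : a <= m ->
  count_partitions n (bounded_with_half_sum a m.+1 k) =
  count_partitions n (bounded_with_half_sum a m k) +
  (if (m < n) && (m.+1./2 <= k) then
     count_partitions (n - m.+1) (bounded_with_half_sum a m.+1 (k - m.+1./2))
   else 0).
Proof.
move=> leam; have geqT : transitive geq by move=> y x z /= ? ?; lia.
pose L1 := partition_list n (bounded_with_half_sum a m k).
pose L2 := if (m < n) && (m.+1./2 <= k) then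
  [seq m.+1 :: s | s <- partition_list (n - m.+1)
     (bounded_with_half_sum a m.+1 (k - m.+1./2))] else [::].
rewrite (@count_partitions_size _ _ (L1 ++ L2)).
- rewrite size_cat size_partition_list /L2; case: ifP => // _.
  by rewrite size_map size_partition_list.
- rewrite cat_uniq partition_list_uniq /=; apply/andP; split.
    rewrite /L2; case: ifP => // _; apply/hasPn => _ /mapP[s _ ->].
    rewrite /= mem_partition_list /bounded_with_half_sum /= ltnn andbF.
    by rewrite !andbF.
  rewrite /L2; case: ifP => // _; rewrite map_inj_uniq ?partition_list_uniq //.
  by move=> s1 s2 [].
move=> s; rewrite mem_cat mem_partition_list.
(* [L2] consists of exactly the wanted partitions whose head is [m+1]. *)
have memL2 : (s \in L2) = if s is x :: s' then
    (x == m.+1) && (is_partition n s && bounded_with_half_sum a m.+1 k s)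
    else false.
  case: s => [|x s].
    by rewrite /L2; case: ifP => // _; apply/mapP; case.
  have consE : (m.+1 :: s \in L2) =
      is_partition n (m.+1 :: s) && bounded_with_half_sum a m.+1 k (m.+1 :: s).
    rewrite /is_partition /bounded_with_half_sum /half_sum /= (path_sortedE geqT).
    rewrite leqnn ltnS leam /= /L2; case: ifP => [le2|]; last first.
      by move=> nle; rewrite in_nil; apply/esym/negbTE/negP; lia.
    rewrite mem_map; last by move=> s1 s2 [].
    rewrite mem_partition_list /is_partition /bounded_with_half_sum /half_sum.
    have [bnd|_] := boolP (all (fun x0 => a < x0 <= m.+1) s); last first.
      by rewrite !andbF.
    have -> : all (geq m.+1) s.
      by apply: sub_all bnd => y /= /andP[].
    by rewrite /=; lia.
  have [->|neq] /= := eqVneq x m.+1; first exact: consE.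
  rewrite /L2; case: ifP => // _; apply/mapP => -[s' _ [eqx _]].
  by rewrite eqx eqxx in neq.
rewrite memL2; case: s {memL2} => [|x s]; first by rewrite orbF.
have [->|neq] /= := eqVneq x m.+1.
  by rewrite /bounded_with_half_sum /= ltnn !andbF.
(* The head differs from [m+1] and dominates the other parts, so the bounds [m+1] and [m] agree on
   all of them. *)
rewrite orbF; case: (boolP (is_partition n _)) => //= /and3P[srt _ _].
rewrite /bounded_with_half_sum /=; congr (_ && _).
have -> : (a < x <= m.+1) = (a < x <= m) by lia.
case: (boolP (a < x <= m)) => //= /andP[_ lexm].
apply: eq_in_all => y ys.
have /= leyx := allP (order_path_min geqT srt) _ ys.
by lia.
Qed.

Lemma count_partitions_bounded_ge a m n k : n <= m ->
  count_partitions n (bounded_with_half_sum a m k) =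
  count_partitions n (fun s => all (ltn a) s && (half_sum s == k)).
Proof.
move=> lenm; apply: eq_count_partitions => s /and3P[_ _ /eqP sums].
congr (_ && _); apply: eq_in_all => x xs /=.
suff : x <= sumn s by lia.
by elim: s xs {sums} => //= y s IH; rewrite inE => /orP[/eqP ->|/IH]; lia.
Qed.

(** A part [x] is [2i] or [2i+1] for [i = x./2] only, so it contributes [x./2] to the sum. *)
Lemma sum_freq_half (s : seq nat) N : all (fun x => x./2 <= N) s ->
  \sum_(1 <= i < N.+1) i * (freq s i.*2 + freq s i.*2.+1) = half_sum s.
Proof.
elim: s => [_|x s IH /= /andP[lexN /IH IHs]].
  by rewrite big1 // => i _; rewrite muln0.
rewrite /half_sum /= -/(half_sum s) -IHs.
transitivity (\sum_(1 <= i < N.+1) i * (x./2 == i) +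
   \sum_(1 <= i < N.+1) i * (freq s i.*2 + freq s i.*2.+1)).
  rewrite -big_split; apply: eq_bigr => i _ /=; rewrite -mulnDr; congr (_ * _).
  rewrite /freq /= addnACA; congr (_ + _).
  have := odd_double_half x; case: (odd x); lia.
(* The index 0 lies outside the range, but such a part contributes 0 anyway. *)
congr (_ + _); case: (posnP x./2) => [->|x0].
  by rewrite big_nat big1 // => i; case: i => // i _; rewrite muln0.
rewrite (bigD1_seq x./2) ?iota_uniq //=; last by rewrite mem_index_iota x0.
by rewrite eqxx muln1 big1 ?addn0 // => i; rewrite eq_sym => /negbTE ->; rewrite muln0.
Qed.

Lemma ctildeE n k :
  ctilde n k = count_partitions n (fun s => all (ltn 1) s && (half_sum s == k)).
Proof.
apply: eq_count_partitions => s /and3P[_ pos _].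
rewrite sum_freq_half; last first.
  elim: s {pos} => //= x s IH; apply/andP; split; first by lia.
  by apply: sub_all IH => y /=; lia.
congr (_ && _); rewrite /freq eqn0Ngt -has_count has_pred1.
elim: s pos => //= x s IH /andP[x0 /IH]; rewrite inE negb_or => ->.
by congr (_ && _); lia.
Qed.

(** * Meanders without bottom arcs *)

Section Matching.

Variables (V : finType) (M : {set {set V}}).
Hypothesis card_M : {in M, forall e : {set V}, #|e| = 2}.
Hypothesis disjoint_M :
  forall e e' x, e \in M -> e' \in M -> x \in e -> x \in e' -> e = e'.

(** All edges carry the label [true] of top edges, so that a meander without bottom arcs is
    literally of this form. *)
Definition matching_graph : multigraph bool V := [set e | e.1 && (e.2 \in M)].
Local Notation E := matching_graph.

Lemma adjacent_matching u v : adjacent E u v = ([set u; v] \in M).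
Proof.
apply/existsP/idP => [[[b e]]|uvM].
  by rewrite !inE /= => /andP[/andP[_ eM] /eqP <-].
by exists (true, [set u; v]); rewrite !inE /= uvM eqxx.
Qed.

(** Edges sharing a vertex coincide, so a walk never leaves its first edge. *)
Lemma connect_matching u v :
  connect (adjacent E) u v = (u == v) || [exists e in M, (u \in e) && (v \in e)].
Proof.
apply/idP/idP => [/connectP[p]|].
  elim: p u => [|w p IH] u /=; first by move=> _ ->; rewrite eqxx.
  rewrite adjacent_matching => /andP[uwM /IH{}IH] /IH; case/orP => [/eqP <-|].
    apply/orP; right; apply/existsP; exists [set u; w].
    by rewrite uwM !inE !eqxx orbT.
  case/existsP => e /and3P[eM we ve]; apply/orP; right; apply/existsP; exists e.
  rewrite eM ve andbT -(disjoint_M uwM eM _ we) ?set21 ?set22 //.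
case/orP => [/eqP ->|/existsP[e /and3P[eM ue ve]]]; first exact: connect0.
have [->|neq] := eqVneq u v; first exact: connect0.
apply: connect1; rewrite adjacent_matching.
suff -> : [set u; v] = e by [].
by apply/eqP; rewrite eqEcard subUset !sub1set ue ve card_M // cards2 neq.
Qed.

Lemma component_matched e v : e \in M -> v \in e ->
  [set y in [set: V] | connect (adjacent E) v y] = e.
Proof.
move=> eM ve; apply/setP => y; rewrite !inE connect_matching /=.
apply/idP/idP => [/orP[/eqP <- //|/existsP[e' /and3P[e'M ve' ye']]]|ye].
  by rewrite (disjoint_M eM e'M ve ve').
by apply/orP; right; apply/existsP; exists e; rewrite eM ve ye.
Qed.

Lemma component_unmatched v : {in M, forall e : {set V}, v \notin e} ->
  [set y in [set: V] | connect (adjacent E) v y] = [set v].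
Proof.
move=> vM; apply/setP => y; rewrite !inE connect_matching /= eq_sym.
case: eqP => //= _; apply/negbTE/negP => /existsP[e /and3P[eM ve _]].
by move: (vM _ eM); rewrite ve.
Qed.

Lemma components_matchingP D : D \in components E ->
  D \in M \/ exists2 v, D = [set v] & {in M, forall e : {set V}, v \notin e}.
Proof.
case/imsetP => v _ ->.
have [/existsP[e /andP[eM ve]]|/existsPn nM] := boolP [exists e in M, v \in e].
  by left; rewrite (component_matched eM ve).
have vM : {in M, forall e : {set V}, v \notin e}.
  by move=> e eM; have := nM e; rewrite eM.
by right; exists v; rewrite // component_unmatched.
Qed.

Lemma matching_sub_components : M \subset components E.
Proof.
apply/subsetP => e eM; have /card_gt0P[v ve] : 0 < #|e| by rewrite card_M.
by apply/imsetP; exists v; rewrite ?inE // (component_matched eM ve).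
Qed.

Lemma partition_components_matching : partition (components E) [set: V].
Proof.
apply: equivalence_partitionP => x y z _ _ _; split; first exact: connect0.
move=> xy; apply/idP/idP; last exact: connect_trans.
(* Only symmetry remains, and the description of [connect] by a common edge is symmetric. *)
apply: connect_trans; rewrite connect_matching.
move: xy; rewrite connect_matching => /orP[/eqP ->|/existsP[e /and3P[eM xe ye]]].
  by rewrite eqxx.
by apply/orP; right; apply/existsP; exists e; rewrite eM xe ye.
Qed.

Lemma degree_matching v : degree E v <= 1.
Proof.
apply/card_le1_eqP => -[b1 e1] [b2 e2]; rewrite !inE /=.
move=> /andP[/andP[b1T e1M] ve1] /andP[/andP[b2T e2M] ve2].
by rewrite b1T b2T (disjoint_M e1M e2M ve1 ve2).
Qed.

(** A component is an edge or one unmatched vertex. Reading [D \in M] as 0 or 1, here and in the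
    edge count below, makes the tree equation of [is_path] immediate. *)
Lemma card_component_matching D :
  D \in components E -> #|D| = (D \in M).+1.
Proof.
case/components_matchingP => [DM|[v -> vM]]; first by rewrite card_M ?DM.
rewrite cards1; case: (boolP ([set v] \in M)) => // /vM.
by rewrite set11.
Qed.

Lemma card_edges_in_matching D :
  D \in components E -> #|edges_in E D| = (D \in M).
Proof.
case/components_matchingP => [DM|[v -> vM]].
  rewrite DM /= -(cards1 (true, D)); apply: eq_card => -[b e]; rewrite !inE /=.
  apply/idP/eqP => [/andP[/andP[bT eM] eD]|[-> ->]]; last by rewrite DM subxx.
  have /card_gt0P[x xe] : 0 < #|e| by rewrite card_M.
  by rewrite bT (disjoint_M eM DM xe (subsetP eD _ xe)).
rewrite (_ : edges_in E [set v] = set0).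
  rewrite cards0; case: (boolP ([set v] \in M)) => // /vM.
  by rewrite set11.
apply/setP => -[b e]; rewrite !inE /=; apply/negbTE/negP.
case/andP => /andP[_ eM] /subsetP ev.
have /card_gt0P[x xe] : 0 < #|e| by rewrite card_M.
by move: (ev _ xe) (vM _ eM); rewrite inE => /eqP <-; rewrite xe.
Qed.

Lemma num_cycles_matching : num_cycles E = 0.
Proof.
apply/eqP; rewrite cards_eq0; apply/eqP/setP => D; rewrite !inE.
apply/negbTE/negP => /andP[DE /forallP cyc].
have /card_gt0P[v vD] : 0 < #|D| by rewrite card_component_matching.
by have := degree_matching v; have := cyc v; rewrite vD => /eqP ->.
Qed.

(** Every component is a path. Summing the component sizes [1 + (D \in M)] counts the vertices, and
    each edge of [M] is itself a component. *)
Lemma num_paths_matching : num_paths E + #|M| = #|V|.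
Proof.
rewrite -[RHS]cardsT (card_partition partition_components_matching).
rewrite (eq_bigr (fun D => 1 + (D \in M))); last first.
  by move=> D /card_component_matching ->.
rewrite big_split sum1_card /=; congr (_ + _).
  apply: eq_card => D; rewrite inE; case: (boolP (D \in _)) => //= DE.
  rewrite /is_path card_edges_in_matching // card_component_matching // eqxx.
  rewrite andbT; apply/forallP => v; apply/implyP => _.
  exact: leqW (degree_matching v).
rewrite -sum1_card big_mkcond [RHS]big_mkcond; apply: eq_bigr => D _.
case: (boolP (D \in M)) => [/(subsetP matching_sub_components) ->//|_].
by case: ifP.
Qed.

End Matching.

(** * The arcs of a block decomposition form a matching *)

Section Arcs.

Variables (n : nat) (s : seq nat).
Hypothesis sum_s : sumn s = n.

(** Selecting vertices by their position in the row makes this total in [i] and [j], with no bound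
    proofs to carry. *)
Definition arc (i j : nat) : {set 'I_n} :=
  [set x : 'I_n | (x == flatten_index s i j :> nat) ||
                  (x == flatten_index s i ((nth 0 s i).-1 - j) :> nat)].

Lemma arc_pair i j : j < (nth 0 s i)./2 ->
  exists u v : 'I_n, [/\ u = flatten_index s i j :> nat,
    v = flatten_index s i ((nth 0 s i).-1 - j) :> nat & arc i j = [set u; v]].
Proof.
move=> ltj.
have ltu : flatten_index s i j < n by rewrite -sum_s flatten_indexP //; lia.
have ltv : flatten_index s i ((nth 0 s i).-1 - j) < n.
  by rewrite -sum_s flatten_indexP //; lia.
exists (Ordinal ltu), (Ordinal ltv); split => //.
by apply/setP => x; rewrite !inE.
Qed.

Lemma card_arc i j : j < (nth 0 s i)./2 -> #|arc i j| = 2.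
Proof.
move=> ltj; have [u [v [eu ev ->]]] := arc_pair ltj.
rewrite cards2; case: eqVneq => // uv; have := congr1 val uv.
by rewrite /= eu ev /flatten_index; lia.
Qed.

(** A vertex determines its arc: [j] is the smaller of its offset in the block and the mirrored
    offset. Both disjointness and the count of arcs follow. *)
Lemma mem_arc i j (x : 'I_n) : j < (nth 0 s i)./2 -> x \in arc i j ->
  reshape_index s x = i /\
  minn (reshape_offset s x) ((nth 0 s i).-1 - reshape_offset s x) = j.
Proof.
by move=> ltj; rewrite inE => /orP[] /eqP ->;
  rewrite flatten_indexKl ?flatten_indexKr //; lia.
Qed.

Lemma arcsP e : reflect
  (exists i j, [/\ i < size s, j < (nth 0 s i)./2 & e = arc i j])
  (e \in arcs n s).
Proof.
rewrite inE; apply: (iffP existsP) => [[i /existsP[j /existsP[u /existsP[v]]]]|].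
  case/and3P => /eqP eu /eqP ev /eqP ->; exists i, j; split => //.
  by apply/setP => x; rewrite !inE -!val_eqE /= eu ev.
case=> i [j [lti ltj ->]]; exists (Ordinal lti); apply/existsP.
exists (Ordinal ltj : 'I_((nth 0 s (Ordinal lti))./2)).
have [u [v [eu ev ->]]] := arc_pair ltj.
apply/existsP; exists u; apply/existsP; exists v.
by rewrite /= eu ev !eqxx.
Qed.

Lemma card_in_arcs : {in arcs n s, forall e : {set _}, #|e| = 2}.
Proof. by move=> _ /arcsP[i [j [_ ltj ->]]]; rewrite card_arc. Qed.

Lemma disjoint_arcs e e' x :
  e \in arcs n s -> e' \in arcs n s -> x \in e -> x \in e' -> e = e'.
Proof.
move=> /arcsP[i [j [_ ltj ->]]] /arcsP[i' [j' [_ ltj' ->]]].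
move=> /(mem_arc ltj)[<- <-] /(mem_arc ltj')[ei].
by rewrite -ei => <-.
Qed.

Lemma card_arcs : #|arcs n s| = half_sum s.
Proof.
(* Arcs are indexed injectively by a block and a position in its first half, a dependent pair. *)
pose T := {i : 'I_(size s) & 'I_((nth 0 s i)./2)}.
pose f (p : T) := arc (tag p) (tagged p).
have -> : arcs n s = f @: [set: T].
  apply/setP => e; apply/arcsP/imsetP => [[i [j [lti ltj ->]]]|[[i j] _ ->]].
    exists (existT (fun i : 'I_(size s) => 'I_((nth 0 s i)./2))
      (Ordinal lti) (Ordinal ltj)) => //.
  by exists i, j; split.
rewrite card_imset => [|[i j] [i' j']].
  rewrite cardsT card_tagged /half_sum sumnE big_map big_enum /=.
  rewrite sumnE big_map (big_nth 0) big_mkord.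
  by apply: eq_bigr => i _; rewrite card_ord.
rewrite /f /= => eqa.
have /card_gt0P[x xa] : 0 < #|arc i j| by rewrite card_arc.
have [ei ej] := mem_arc (ltn_ord j) xa.
rewrite eqa in xa; have [ei' ej'] := mem_arc (ltn_ord j') xa.
have eqi : i = i' by apply: val_inj; rewrite /= -ei -ei'.
case: i' / eqi j' {eqa xa ei ei'} ej' => j' ej'; congr existT.
by apply: val_inj; rewrite /= -ej -ej'.
Qed.

End Arcs.

(** A block of size 1 has [1./2 = 0] arcs, so there are no bottom edges. *)
Lemma meander_ones n s :
  meander n s (nseq n 1) = matching_graph (arcs n s).
Proof.
apply/setP => -[[] e]; rewrite !inE //=.
apply/negbTE/negP => /existsP[i /existsP[[j ltj]]].
have lti : i < n by have := ltn_ord i; rewrite [X in _ < X]size_nseq.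
by exfalso; move: ltj; rewrite nth_nseq lti.
Qed.

(** With no cycle and [n - half_sum s] paths, the index is [n - half_sum s - 1]. *)
Lemma cE n k :
  c n k = count_partitions n (fun s => all (ltn 0) s && (half_sum s == k)).
Proof.
apply: eq_count_partitions => s /and3P[_ pos /eqP sums].
rewrite (_ : all (ltn 0) s) //= /meander_index meander_ones.
have cardM := card_in_arcs sums; have disjM := disjoint_arcs sums.
rewrite num_cycles_matching //.
have := num_paths_matching cardM disjM; rewrite card_arcs // card_ord.
by lia.
Qed.

(** * Generating series *)

Local Open Scope ring_scope.

Section FormalPowerSeries.

Variable R : comNzRingType.
Implicit Types (f g : fps R) (a : R).

Lemma fcoef1 i : fcoef (1 : fps R) i = (i == 0%N)%:R.
Proof. by rewrite /= /fpsC /=; case: eqP. Qed.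

Lemma fcoefCM a f i : fcoef (fpsC a * f) i = a * fcoef f i.
Proof.
rewrite /= big_ord_recl /= subn0 big1 ?addr0 // => j _.
by rewrite mul0r.
Qed.

Lemma fcoefXM f i : fcoef (fpsX R * f) i = if i is j.+1 then fcoef f j else 0.
Proof.
case: i => [|j] /=; first by rewrite big_ord1 mul0r.
rewrite big_ord_recl mul0r add0r big_ord_recl /= mul1r subSS subn0.
by rewrite big1 ?addr0 // => l _; rewrite mul0r.
Qed.

Lemma fcoefXnM m f i :
  fcoef (fpsX R ^+ m * f) i = if (m <= i)%N then fcoef f (i - m)%N else 0.
Proof.
elim: m i => [|m IH] i; first by rewrite expr0 mul1r subn0.
by rewrite exprS -mulrA fcoefXM; case: i => [|i] //; rewrite IH subSS.
Qed.

Lemma fpsCX a m : fpsC (a ^+ m) = fpsC a ^+ m.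
Proof.
elim: m => [|m IH]; first by [].
rewrite exprS [RHS]exprS -IH; apply: fpsP => i; rewrite fcoefCM /=.
by case: eqP => //; rewrite mulr0.
Qed.

(** Congruence modulo the power [n+1] of the variable, used to replace infinite products by finite
    ones. *)
Definition fps_eqmod n f g := forall i, (i <= n)%N -> fcoef f i = fcoef g i.

Lemma fps_eqmodM n f1 f2 g1 g2 :
  fps_eqmod n f1 f2 -> fps_eqmod n g1 g2 -> fps_eqmod n (f1 * g1) (f2 * g2).
Proof.
move=> f12 g12 i lin /=; apply: eq_bigr => j _.
have ltji := ltn_ord j.
by rewrite f12 1?g12 //; lia.
Qed.

End FormalPowerSeries.

Lemma coef_monomialM (h m k n : nat) (f : fps_tq) :
  coef_tq (t ^+ h * q ^+ m * f) k n =
  if (m <= n)%N && (h <= k)%N then coef_tq f (k - h) (n - m) else 0.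
Proof.
rewrite /coef_tq -mulrA -fpsCX fcoefCM fcoefXnM /q.
by case: (leqP h k) => _; rewrite ?andbF // fcoefXnM andbT; case: ifP.
Qed.

(** The omitted factors [1 - a t^j q^(2j)] have [j >= m], hence [2j > n], and are 1 modulo
    [q^(n+1)]. *)
Lemma qpoch_eqmod (a : fps_tq) (n m : nat) : (n < m)%N ->
  fps_eqmod n (qpoch a (t * q ^+ 2)) (\prod_(j < m) (1 - a * (t * q ^+ 2) ^+ j)).
Proof.
set F := fun m => \prod_(j < m) (1 - a * (t * q ^+ 2) ^+ j).
have step l i : (i <= l)%N -> fcoef (F l.+1) i = fcoef (F l.+2) i.
  move=> leil.
  have -> : F l.+2 = F l.+1 - t ^+ l.+1 * (q ^+ (2 * l.+1) * (F l.+1 * a)).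
    rewrite {1}/F big_ord_recr /= -/(F l.+1) mulrBr mulr1 exprMn -exprM.
    by congr (_ - _); rewrite [LHS]mulrA [LHS]mulrC -mulrA.
  set f := _ * (_ * _); rewrite -[RHS]/(fcoef (F l.+1) i - fcoef f i) /f.
  rewrite -fpsCX fcoefCM fcoefXnM ifF ?mulr0 ?subr0 //.
  by lia.
have stable l d i : (i <= l)%N -> fcoef (F (l.+1 + d)%N) i = fcoef (F l.+1) i.
  move=> leil; elim: d => [|d IH]; first by rewrite addn0.
  by rewrite addnS addSn -step -?addSn ?IH //; lia.
have lim i : fcoef (qpoch a (t * q ^+ 2)) i = fcoef (F i.+1) i.
  (* The limit is diagonal: the coefficient of [q^j] has stabilised in [F j.+1]. *)
  rewrite /qpoch (@converges_tq_lim _ (Fps (fun j => fcoef (F j.+1) j))) //.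
  move=> k j; exists j.+1 => l ltjl; rewrite /coef_tq /= -/(F l).
  by rewrite -(subnKC ltjl) stable.
move=> ltnm i lein; rewrite lim -/(F m).
by have ltim : (i < m)%N by [lia]; rewrite -(subnKC ltim) stable.
Qed.

(** * Product formula for partitions with bounded parts *)

Definition bounded_series (a m : nat) : fps_tq :=
  series_tq (fun k n => (count_partitions n (bounded_with_half_sum a m k))%:Z).

Lemma bounded_series0 a : bounded_series a a = 1.
Proof.
apply: fpsP => n; apply: fpsP => k; rewrite fcoef1 /=.
rewrite count_partitions_bounded0.
case: (n == 0%N) => //.
transitivity ((k == 0%N)%:R : int); first by case: (k == 0%N).
by rewrite -fcoef1.
Qed.

Lemma bounded_seriesS a m : (a <= m)%N ->
  bounded_series a m.+1 * (1 - t ^+ m.+1./2 * q ^+ m.+1) = bounded_series a m.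
Proof.
move=> leam; rewrite mulrBr mulr1 [X in _ - X]mulrC.
apply/eqP; rewrite subr_eq; apply/eqP; apply: fpsP => n; apply: fpsP => k.
rewrite -[LHS]/((count_partitions n (bounded_with_half_sum a m.+1 k))%:Z).
rewrite -[RHS]/((count_partitions n (bounded_with_half_sum a m k))%:Z +
  coef_tq (t ^+ m.+1./2 * q ^+ m.+1 * bounded_series a m.+1) k n).
rewrite coef_monomialM count_partitions_boundedS // PoszD.
by congr (_ + _); case: ifP.
Qed.

(** Pairing the consecutive sizes [a+2j+1] and [a+2j+2] lets the product split by parity into two
    q-Pochhammer truncations. *)
Lemma bounded_series_prod a m :
  bounded_series a (a + m.*2) *
  \prod_(j < m) ((1 - t ^+ (a + j.*2).+1./2 * q ^+ (a + j.*2).+1) *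
                 (1 - t ^+ (a + j.*2).+2./2 * q ^+ (a + j.*2).+2)) = 1.
Proof.
elim: m => [|m IH]; first by rewrite addn0 big_ord0 mulr1 bounded_series0.
have le1 := leq_addr m.*2 a.
have mulE (b p u v : fps_tq) : b * (p * (u * v)) = b * v * u * p.
  by rewrite [p * _]mulrC [u * v]mulrC !mulrA.
rewrite big_ord_recr doubleS !addnS mulE.
by rewrite (bounded_seriesS (leqW le1)) (bounded_seriesS le1).
Qed.

Lemma qpochs2 (x y b : fps_tq) : qpochs [:: x; y] b = qpoch x b * qpoch y b.
Proof. by rewrite /qpochs big_cons big_seq1. Qed.

Lemma series_eq_qpochs (a : nat) (x y : fps_tq) (C : nat -> nat -> nat) :
  (forall j, x * (t * q ^+ 2) ^+ j
     = t ^+ (a + j.*2).+1./2 * q ^+ (a + j.*2).+1) ->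
  (forall j, y * (t * q ^+ 2) ^+ j
     = t ^+ (a + j.*2).+2./2 * q ^+ (a + j.*2).+2) ->
  (forall n k, C n k =
     count_partitions n (fun s => all (ltn a) s && (half_sum s == k))) ->
  series_tq (fun k n => (C n k)%:Z) = 1 / qpochs [:: x; y] (t * q ^+ 2).
Proof.
move=> xE yE CE; set S := series_tq _; set Q := qpochs _ _.
(* The quotient is a true inverse only for a unit [Q]; the series [S] itself witnesses this. *)
suff SQ : S * Q = 1.
  have Qu : Q \is a GRing.unit by apply/unitrPr; exists S; rewrite mulrC.
  by apply: (mulIr Qu); rewrite divrK.
rewrite /Q qpochs2; apply: fpsP => n.
(* Up to [q^n], parts bounded by [a + 2(n+1)] lose no partition and [n+1] factors of each product
   suffice. *)
suff eqn : fps_eqmod n (S * (qpoch x (t * q ^+ 2) * qpoch y (t * q ^+ 2)))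
  (bounded_series a (a + n.+1.*2) *
   (\prod_(j < n.+1) (1 - t ^+ (a + j.*2).+1./2 * q ^+ (a + j.*2).+1) *
    \prod_(j < n.+1) (1 - t ^+ (a + j.*2).+2./2 * q ^+ (a + j.*2).+2))).
  by rewrite (eqn _ (leqnn n)) -big_split bounded_series_prod.
apply: fps_eqmodM; last first.
  apply: fps_eqmodM.
    under eq_bigr do rewrite -xE.
    exact: qpoch_eqmod.
  under eq_bigr do rewrite -yE.
  exact: qpoch_eqmod.
move=> i lein; apply: fpsP => k /=; rewrite CE count_partitions_bounded_ge //.
by lia.
Qed.

Theorem theorem4 :
  series_tq (fun k n => (c n k)%:Z)
    = 1 / qpochs [:: q; t * q ^+ 2] (t * q ^+ 2)
  /\
  series_tq (fun k n => (ctilde n k)%:Z)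
    = 1 / qpochs [:: t * q ^+ 2; t * q ^+ 3] (t * q ^+ 2).
Proof.
have tqE h m j :
    t ^+ h * q ^+ m * (t * q ^+ 2) ^+ j = t ^+ (h + j) * q ^+ (m + j.*2).
  by rewrite exprMn -exprM mulrACA -!exprD mul2n.
split.
  (* The sizes [2j+1] and [2j+2] have halves [j] and [j+1], giving the bases [q] and [t q^2]. *)
  apply: (@series_eq_qpochs 0) => [j|j|]; last exact: cE.
  - have := tqE 0%N 1%N j; rewrite expr0 mul1r => ->.
    by congr (t ^+ _ * q ^+ _); lia.
  - have := tqE 1%N 2%N j => ->.
    by congr (t ^+ _ * q ^+ _); lia.
(* Without the part 1 the sizes are [2j+2] and [2j+3], both with half [j+1]. *)
apply: (@series_eq_qpochs 1) => [j|j|]; last exact: ctildeE.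
- have := tqE 1%N 2%N j => ->.
  by congr (t ^+ _ * q ^+ _); lia.
- have := tqE 1%N 3%N j => ->.
  by congr (t ^+ _ * q ^+ _); lia.
Qed.
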